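(* Let $A \in \operatorname{Pd}(2n)$ and $H\in \operatorname{Sm}(2n)$ be such that $A + H \in \operatorname{Pd}(2n)$. Given any $\tilde{S}\in \operatorname{Sp}(2n; A+H)$, there exists $S \in \operatorname{Sp}(2n; A)$ such that $$\|\tilde{S}-S\|= \mathcal{O}(\|H\|).$$
   Context: Notation. $\operatorname{Sm}(m)$ is the set of $m\times m$ real symmetric matrices; $\operatorname{Pd}(2n)\subset\operatorname{Sm}(2n)$ is the set of positive definite ones. $\|\cdot\|$ is the spectral norm (maximum singular value). $I_n$ is the $n\times n$ identity matrix and $J_{2n}=\begin{pmatrix}0&I_n\\-I_n&0\end{pmatrix}$. A real $2n\times 2n$ matrix $S$ is symplectic if $S^TJ_{2n}S=J_{2n}$; $\operatorname{Sp}(2n)$ is the group of such matrices. Williamson's theorem: for every $A\in\operatorname{Pd}(2n)$ there is $S\in\operatorname{Sp}(2n)$ with $S^TAS=D\oplus D=\begin{pmatrix}D&0\\0&D\end{pmatrix}$, where $D$ is an $n\times n$ diagonal matrix with positive diagonal entries $d_1(A)\le\cdots\le d_n(A)$ (listed in this order; repetitions allowed), which do not depend on $S$ and are called the symplectic eigenvalues of $A$. $\operatorname{Sp}(2n;A)$ is the set of all $S\in\operatorname{Sp}(2n)$ with $S^TAS=D\oplus D$ for this $D=\operatorname{diag}(d_1(A),\ldots,d_n(A))$. Big-O: $\|\tilde S-S\|=\mathcal O(\|H\|)$ means that there exist positive scalars $c$ and $\delta$ such that $\|\tilde S-S\|\le c\|H\|$ for all admissible $H$ (i.e. $H\in \operatorname{Sm}(2n)$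 with $A+H\in\operatorname{Pd}(2n)$) with $\|H\|<\delta$. Here $A$ is fixed, $H$ varies, $\tilde S$ is an arbitrary element of $\operatorname{Sp}(2n;A+H)$ for each $H$, and $S$ may depend on $H$ and $\tilde S$. *)

(* Defs.v *)
From HB Require Import structures.
From mathcomp Require Export all_boot all_order all_algebra.
From mathcomp Require Export all_classical all_reals.

Set Implicit Arguments.
Unset Strict Implicit.
Unset Printing Implicit Defensive.

Import Order.TTheory GRing.Theory Num.Theory.

Local Open Scope classical_set_scope.
Local Open Scope ring_scope.

Definition singular_value (R : realType) (m : nat) (M : 'M[R]_m) (s : R) : Prop :=
  0 <= s /\ eigenvalue (M^T *m M) (s ^+ 2).

(* The set of singular values is finite, and nonempty when m > 0, so the
   supremum is a maximum; for m = 0 it is sup set0 = 0. *)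
Definition spectral_norm (R : realType) (m : nat) (M : 'M[R]_m) : R :=
  sup [set s | singular_value M s].

Definition Sm (R : realType) (m : nat) : set 'M[R]_m :=
  [set A | A \is symmetricmx].

Definition Pd (R : realType) (m : nat) : set 'M[R]_m :=
  [set A | Sm A /\ forall x : 'cV[R]_m, x != 0 -> 0 < (x^T *m A *m x) 0 0].

Definition J (R : realType) (n : nat) : 'M[R]_(n + n) :=
  block_mx 0 1%:M (- 1%:M) 0.

Definition Sp (R : realType) (n : nat) : set 'M[R]_(n + n) :=
  [set S | S^T *m J R n *m S = J R n].

Definition diag2 (R : realType) (n : nat) (d : 'rV[R]_n) : 'M[R]_(n + n) :=
  block_mx (diag_mx d) 0 0 (diag_mx d).

Definition williamson_spectrum (R : realType) (n : nat) (A : 'M[R]_(n + n))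
    (d : 'rV[R]_n) : Prop :=
  [/\ forall i, 0 < d 0 i,
      forall i j : 'I_n, (i <= j)%N -> d 0 i <= d 0 j
    & exists2 S, Sp S & S^T *m A *m S = diag2 d].

(* By Williamson's theorem, for A in Pd (n + n) there is exactly one d with
   williamson_spectrum A d; the default value 0 of xget is then not used. *)
Definition symplectic_eigenvalues (R : realType) (n : nat)
    (A : 'M[R]_(n + n)) : 'rV[R]_n :=
  xget 0 [set d | williamson_spectrum A d].

Definition SpA (R : realType) (n : nat) (A : 'M[R]_(n + n)) :
    set 'M[R]_(n + n) :=
  [set S | Sp S /\ S^T *m A *m S = diag2 (symplectic_eigenvalues A)].

(* Main.v *)
Require Import Defs.
From mathcomp Require Import fingroup perm complex ring lra.

Set Implicit Arguments.
Unset Strict Implicit.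
Unset Printing Implicit Defensive.

(** Write [L = diag2 d] for the Williamson form of [A] and fix one symplectic
[S0] with [S0^T A S0 = L]; it exists by [williamson], Williamson's theorem.
Passing to the basis [S0] turns [St] into the symplectic matrix
[X = S0^-1 St] with [X^T (L + E) X = diag2 e], where [E = S0^T H S0] and [e]
lists the symplectic eigenvalues of [A + H].  The candidates [S] for [A] are
the products [S0 Y] with [Y] symplectic and [Y^T L Y = L], so it is enough to
find such a [Y] with [X - Y = O(E)]; this is [williamson_basis_perturbation].

Since [X] is symplectic, the relation for [X] reads
[J^T (L + E) X = X J^T (diag2 e)].  Two facts turn it into a statement about
commutators.  A min-max principle for symplectic eigenvalues
([symplectic_minmax]) gives [e - d = O(E)].  Positivity of [L + E] bounds [X]
([williamson_basis_bound]).  Hence, with [K = J^T L], the commutator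
[K X - X K] is [O(E)].

A matrix that almost commutes with [K] is close to one that commutes with both
[L] and [J] ([near_commutant]): [K^2 = - L^2] forces the entries of [X] between
different symplectic eigenvalues to be small, and after erasing those entries
one averages over conjugation by [J].  This produces [T] in the commutant of
[L] and [J] with [X - T = O(E)].

Such a [T] need not be symplectic, but [T^T T] is close to the identity,
because [J (T^T T) = T^T J T] is close to [X^T J X = J].  The orthogonal factor
[Y = T (T^T T)^(-1/2)] of its polar decomposition still commutes with [L] and
[J], because [T^T T] does; being orthogonal, it satisfies [Y^T J Y = J] and
[Y^T L Y = L] exactly, and [inv_sqrt_near_identity] shows [Y - T = O(E)].

All estimates are made in the entrywise l1 norm [mxl1], which is
submultiplicative and equivalent to the spectral norm. *)

Import Order.TTheory GRing.Theory Num.Theory.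
Local Open Scope classical_set_scope.
Local Open Scope ring_scope.

(** * Euclidean geometry of column vectors *)

Definition dot (R : realType) m (u v : 'cV[R]_m) : R := (u^T *m v) 0 0.

Section Dot.
Variables (R : realType) (m : nat).
Implicit Types u v w : 'cV[R]_m.

Lemma dotE u v : dot u v = \sum_k u k 0 * v k 0.
Proof. by rewrite /dot mxE; apply: eq_bigr => k _; rewrite mxE. Qed.

Lemma dotC u v : dot u v = dot v u.
Proof. by rewrite !dotE; apply: eq_bigr => k _; rewrite mulrC. Qed.

Lemma dotDr u v w : dot u (v + w) = dot u v + dot u w.
Proof. by rewrite /dot mulmxDr mxE. Qed.

Lemma dotDl u v w : dot (u + v) w = dot u w + dot v w.
Proof. by rewrite dotC dotDr !(dotC w). Qed.

Lemma dotZr a u v : dot u (a *: v) = a * dot u v.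
Proof. by rewrite /dot -scalemxAr mxE. Qed.

Lemma dotZl a u v : dot (a *: u) v = a * dot u v.
Proof. by rewrite dotC dotZr dotC. Qed.

Lemma dotNr u v : dot u (- v) = - dot u v.
Proof. by rewrite -scaleN1r dotZr mulN1r. Qed.

Lemma dotNl u v : dot (- u) v = - dot u v.
Proof. by rewrite dotC dotNr dotC. Qed.

Lemma dot_mulmxl (M : 'M_m) u v : dot (M *m u) v = dot u (M^T *m v).
Proof. by rewrite /dot trmx_mul -mulmxA. Qed.

Lemma dot_ge0 u : 0 <= dot u u.
Proof. by rewrite dotE sumr_ge0// => k _; rewrite -expr2 sqr_ge0. Qed.

Lemma dot_eq0 u : (dot u u == 0) = (u == 0).
Proof.
apply/idP/idP => [|/eqP->]; last by rewrite /dot mulmx0 mxE.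
rewrite dotE psumr_eq0 => [/allP u0|k _]; last by rewrite -expr2 sqr_ge0.
apply/eqP/matrixP => k j; rewrite ord1 mxE.
by have /(_ (mem_index_enum k)) := u0 k; rewrite /= mulf_eq0 orbb => /eqP.
Qed.

Lemma dot_gt0 u : u != 0 -> 0 < dot u u.
Proof. by move=> u0; rewrite lt_def dot_eq0 u0 dot_ge0. Qed.

Lemma dot_delta (i j : 'I_m) :
  dot (delta_mx i 0) (delta_mx j 0) = (i == j)%:R :> R.
Proof.
by rewrite /dot trmx_delta mul_delta_mx_cond; case: eqP => _; rewrite mxE ?eqxx.
Qed.

Lemma exists_unit_multiple u : u != 0 -> exists2 a, 0 < a & dot (a *: u) (a *: u) = 1.
Proof.
move=> /dot_gt0 u0; exists (Num.sqrt (dot u u))^-1; first by rewrite invr_gt0 sqrtr_gt0.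
rewrite dotZl dotZr mulrA -invfM -expr2 sqr_sqrtr ?dot_ge0// mulVf//.
by rewrite gt_eqF.
Qed.

(** The reflection in the hyperplane orthogonal to [u - v]; this hyperplane
contains every vector orthogonal to both [u] and [v]. *)
Lemma householder_exchange u v : dot u u = 1 -> dot v v = 1 ->
  exists P : 'M[R]_m, [/\ P^T *m P = 1%:M, P *m u = v, P^T *m v = u &
    forall x, dot u x = 0 -> dot v x = 0 -> P *m x = x].
Proof.
move=> u1 v1; have [->|neq_uv] := eqVneq u v.
  by exists 1%:M; rewrite trmx1 !mul1mx; split=> // x; rewrite mul1mx.
have [w wE] : exists w, w = u - v by exists (u - v).
have w_gt0 : 0 < dot w w by rewrite dot_gt0// wE subr_eq0.
have ww : dot w w = 2 * dot w u.
  by rewrite wE !(dotDl, dotDr, dotNl, dotNr) (dotC v u) u1 v1; ring.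
pose P : 'M[R]_m := 1%:M - (2 / dot w w) *: (w *m w^T).
have PE x : P *m x = x - (2 / dot w w * dot w x) *: w.
  rewrite mulmxBl mul1mx -scalemxAl -mulmxA [w^T *m x]mx11_scalar.
  by rewrite mul_mx_scalar scalerA.
have PT : P^T = P by rewrite /P linearB linearZ /= trmx1 trmx_mul trmxK.
have Pu : P *m u = v.
  have -> : P *m u = u - w; last by rewrite wE opprB addrC subrK.
  rewrite PE ww; congr (_ - _); rewrite -[RHS]scale1r; congr (_ *: _).
  have ? : dot w u != 0 by apply: contraTneq w_gt0 => wu; rewrite ww wu mulr0 ltxx.
  by field.
have PP : P *m P = 1%:M.
  have PPx (x : 'cV_m) : P *m (P *m x) = x.
    rewrite !PE dotDr dotNr dotZr -addrA -opprD -scalerDl.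
    have -> : 2 / dot w w * dot w x +
      2 / dot w w * (dot w x - 2 / dot w w * dot w x * dot w w) = 0.
      by have ? : dot w w != 0 by [rewrite gt_eqF]; field.
    by rewrite scale0r subr0.
  by apply/matrixP => i j; have := congr1 (fun x : 'cV_m => x i 0) (PPx (delta_mx j 0));
    rewrite mulmxA -colE !mxE eqxx andbT.
exists P; rewrite PT; split=> // [|x ux vx]; first by rewrite -Pu mulmxA PP mul1mx.
have wx : dot w x = 0 by rewrite wE dotDl dotNl ux vx subrr.
by rewrite PE wx mulr0 scale0r subr0.
Qed.

End Dot.

(** * Spectral theorem for real symmetric matrices *)

Section Spectral.
Variable R : realType.

(** Over the algebraically closed field [R[i]] an eigenvector [x + i y] exists;
symmetry of [M], tested on [x] and [y], forces the imaginary part of the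
eigenvalue to vanish, and then [x] or [y] is a real eigenvector. *)
Lemma symmetric_eigenvector m (M : 'M[R]_m.+1) : M^T = M ->
  exists a (v : 'cV[R]_m.+1), dot v v = 1 /\ M *m v = a *: v.
Proof.
move=> Msym.
have [//|a /eigenvalueP[z zM z0]] :=
  @eigenvalue_closed R[i] m.+1 (map_mx (real_complex R) M).
pose x := map_mx (@complex.Re R) z; pose y := map_mx (@complex.Im R) z.
have eqM (f : R[i] -> R) : (forall p q, f (p + q) = f p + f q) -> f 0 = 0 ->
    (forall p (q : R), f (p * (q%:C)%C) = f p * q) ->
    map_mx f z *m M = map_mx f (a *: z).
  move=> fD f0 fM; rewrite -zM; apply/matrixP => i j; rewrite !mxE.
  rewrite (big_morph f fD f0); apply: eq_bigr => k _; by rewrite !mxE fM.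
have ReM : x *m M = complex.Re a *: x - complex.Im a *: y.
  rewrite eqM//; last by case=> p q r /=; rewrite mulr0 subr0.
    by apply/matrixP => i j; rewrite !mxE; case: a {zM eqM} => ? ?; case: (z i j).
  by case=> ? ? [].
have ImM : y *m M = complex.Im a *: x + complex.Re a *: y.
  rewrite eqM//; last by case=> p q r /=; rewrite mulr0 add0r.
    apply/matrixP => i j; rewrite !mxE.
    by case: a {zM eqM ReM} => ? ?; case: (z i j) => ? ? /=; rewrite addrC.
  by case=> ? ? [].
have colM (u : 'rV[R]_m.+1) : M *m u^T = (u *m M)^T by rewrite trmx_mul Msym.
have xy0 : (x^T != 0) || (y^T != 0).
  rewrite -negb_and; apply: contra z0 => /andP[/eqP x0 /eqP y0].
  apply/eqP/matrixP => i j; rewrite mxE; apply/eqP; rewrite eq_complex /=.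
  move: (congr1 (fun u : 'cV_m.+1 => u j i) x0) (congr1 (fun u : 'cV_m.+1 => u j i) y0).
  by rewrite !mxE => -> ->; rewrite eqxx.
have Ima : complex.Im a = 0.
  have : dot (M *m x^T) y^T = dot x^T (M *m y^T) by rewrite dot_mulmxl Msym.
  rewrite !colM ReM ImM !linearD /= !linearN /= !linearZ /=.
  rewrite !(dotDl, dotDr, dotNl, dotNr, dotZl, dotZr) => e.
  have : complex.Im a * (dot x^T x^T + dot y^T y^T) = 0 by lra.
  move/eqP; rewrite mulf_eq0 => /orP[/eqP//|].
  rewrite paddr_eq0 ?dot_ge0// !dot_eq0 => /andP[/eqP x0 /eqP y0].
  by move: xy0; rewrite x0 y0 eqxx.
suff [v v0 Mv] : exists2 v : 'cV[R]_m.+1, v != 0 & M *m v = complex.Re a *: v.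
  have [b b0 b1] := exists_unit_multiple v0.
  exists (complex.Re a), (b *: v); split=> //.
  by rewrite -scalemxAr Mv !scalerA mulrC.
case/orP: xy0 => [x0|y0]; [exists x^T|exists y^T] => //; rewrite colM.
  by rewrite ReM Ima scale0r subr0 linearZ.
by rewrite ImM Ima scale0r add0r linearZ.
Qed.

(** A reflection moves a unit eigenvector to the first basis vector; symmetry
then makes the conjugated matrix block diagonal, and the lower block is handled
by induction. *)
Theorem symmetric_spectral m (M : 'M[R]_m) : M^T = M ->
  exists (Q : 'M[R]_m) (g : 'rV[R]_m), Q^T *m Q = 1%:M /\ M = Q *m diag_mx g *m Q^T.
Proof.
elim: m M => [|m IH] M Msym.
  by exists 1%:M, 0; split; apply/matrixP; case.
have [a [v [v1 Mv]]] := symmetric_eigenvector Msym.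
have [|P [PP Pv PTv _]] := @householder_exchange R m.+1 v (delta_mx 0 0) v1.
  by rewrite dot_delta eqxx.
have PP' : P *m P^T = 1%:M by apply: mulmx1C.
pose N : 'M_(1 + m) := P *m M *m P^T.
have Nsym : N^T = N by rewrite /N !trmx_mul trmxK Msym mulmxA.
have Ne : N *m delta_mx 0 0 = a *: delta_mx 0 0 :> 'cV_(1 + m).
  by rewrite -!mulmxA PTv Mv -scalemxAr Pv.
have Nl : lsubmx N = col_mx a%:M 0.
  apply/matrixP => i j; rewrite ord1 mxE.
  have -> : lshift m (0 : 'I_1) = 0 :> 'I_(1 + m) by apply: val_inj.
  move/matrixP/(_ i 0): Ne; rewrite -colE !mxE => ->.
  case: (split_ordP i) => k ->; rewrite ?col_mxEu ?col_mxEd !mxE andbT.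
    by rewrite !ord1 mulr1.
  by rewrite mulr0.
have NE : N = block_mx a%:M 0 0 (drsubmx N).
  have ul : ulsubmx N = a%:M.
    rewrite -[RHS](col_mxKu _ (0 : 'cV_m)) -Nl.
    by apply/matrixP => i j; rewrite !mxE.
  have dl : dlsubmx N = 0.
    rewrite -[RHS](col_mxKd (a%:M : 'M_1)) -Nl.
    by apply/matrixP => i j; rewrite !mxE.
  have ur : ursubmx N = 0 by rewrite -[LHS]trmxK trmx_ursub Nsym dl trmx0.
  by rewrite -[LHS]submxK ul dl ur.
have [|Q [g [QQ NQ]]] := IH (drsubmx N); first by rewrite trmx_drsub Nsym.
pose B : 'M_(1 + m) := block_mx (1%:M : 'M_1) 0 0 Q.
have BT : B^T = block_mx 1%:M 0 0 Q^T by rewrite tr_block_mx !trmx0 trmx1.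
have BB : B^T *m B = 1%:M.
  by rewrite BT mulmx_block !(mulmx0, mul0mx, addr0, add0r) mul1mx QQ -scalar_mx_block.
have NB : N = B *m diag_mx (row_mx a%:M g) *m B^T.
  rewrite NE NQ BT diag_mx_row !mulmx_block.
  rewrite !(mulmx0, mul0mx, addr0, add0r, mul1mx, mulmx1).
  congr block_mx; apply/matrixP => i j; by rewrite !ord1 !mxE eqxx.
exists (P^T *m B), (row_mx a%:M g : 'rV_(1 + m)); split.
  by rewrite trmx_mul trmxK -mulmxA (mulmxA P) PP' mul1mx.
have -> : M = P^T *m N *m P.
  by rewrite /N !mulmxA PP mul1mx -!mulmxA PP mulmx1.
by rewrite trmx_mul trmxK NB !mulmxA.
Qed.

End Spectral.

(** * Canonical form of invertible skew-symmetric matrices *)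

Section Skew.
Variable R : realType.

(** If [v] is an eigenvector of [K^T K = - K^2] for [a ^+ 2], then [v] and
[K v] span a plane stable under [K], on which [K] is [a] times a rotation by a
right angle. *)
Lemma skew_eigenplane m (K : 'M[R]_m.+1) : K^T = - K ->
  (forall x : 'cV_m.+1, K *m x = 0 -> x = 0) ->
  exists a (v w : 'cV[R]_m.+1), [/\ 0 < a, dot v v = 1, dot w w = 1 & dot v w = 0] /\
    (K *m v = - a *: w /\ K *m w = a *: v).
Proof.
move=> Kskew Kinj.
have [|b [v [v1 KKv]]] := @symmetric_eigenvector _ _ (K^T *m K).
  by rewrite trmx_mul trmxK.
have bE : b = dot (K *m v) (K *m v).
  by rewrite dot_mulmxl mulmxA KKv dotZr v1 mulr1.
have b_gt0 : 0 < b.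
  rewrite bE dot_gt0//; apply: contraTneq isT => /Kinj v0.
  by move: v1; rewrite v0 /dot mulmx0 mxE => /esym/eqP; rewrite oner_eq0.
pose a := Num.sqrt b.
have a_gt0 : 0 < a by rewrite sqrtr_gt0.
have a2 : a ^+ 2 = b by rewrite sqr_sqrtr// ltW.
have a0 : a != 0 by rewrite gt_eqF.
exists a, v, (- a^-1 *: (K *m v)); split; split=> //.
- by rewrite dotZl dotZr -bE -a2; field.
- have : dot (K *m v) v = - dot v (K *m v) by rewrite dot_mulmxl Kskew mulNmx dotNr.
  by rewrite dotC dotZr => ?; have -> : dot v (K *m v) = 0 by [lra]; rewrite mulr0.
- by rewrite scalerA mulrNN mulfV// scale1r.
- rewrite -scalemxAr mulmxA -[X in X *m K]opprK -Kskew mulNmx mulNmx KKv -a2.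
  by rewrite scalerN scaleNr opprK scalerA expr2 mulrA mulVf// mul1r.
Qed.

(** Two successive reflections: the second one fixes the image of [v] because
the image of [w] stays orthogonal to it. *)
Lemma orthonormal_pair_frame m (v w : 'cV[R]_m) (i j : 'I_m) : i != j ->
  dot v v = 1 -> dot w w = 1 -> dot v w = 0 ->
  exists P : 'M[R]_m, [/\ P^T *m P = 1%:M,
    P *m v = delta_mx i 0, P *m w = delta_mx j 0,
    P^T *m delta_mx i 0 = v & P^T *m delta_mx j 0 = w].
Proof.
move=> ij v1 w1 vw.
have e1 (k : 'I_m) : dot (delta_mx k 0) (delta_mx k 0) = 1 :> R.
  by rewrite dot_delta eqxx.
have [P [PP Pv _ _]] := householder_exchange v1 (e1 i).
have Pw1 : dot (P *m w) (P *m w) = 1 by rewrite dot_mulmxl mulmxA PP mul1mx.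
have [Q [QQ Qw _ Qfix]] := householder_exchange Pw1 (e1 j).
have Qi : Q *m delta_mx i 0 = delta_mx i 0 :> 'cV_m.
  apply: Qfix; last by rewrite dot_delta eq_sym (negbTE ij).
  by rewrite -Pv dot_mulmxl mulmxA PP mul1mx dotC.
have QP : (Q *m P)^T *m (Q *m P) = 1%:M.
  by rewrite trmx_mul -mulmxA (mulmxA _ Q) QQ mul1mx.
have QPv : Q *m P *m v = delta_mx i 0 by rewrite -mulmxA Pv.
have QPw : Q *m P *m w = delta_mx j 0 by rewrite -mulmxA Qw.
by exists (Q *m P); split=> //; rewrite -?QPv -?QPw mulmxA QP mul1mx.
Qed.

(** Induction on [n]: an eigenplane of [K] is moved to the plane of the two
coordinates [0] and [n.+1], which are the first ones of the two halves.  What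
remains of the four blocks is again skew-symmetric and injective, and has size
[n + n].  Injectivity is stated on vectors because it passes to the remaining
blocks by padding a vector with zeros. *)
Theorem skew_canonical n (K : 'M[R]_(n + n)) : K^T = - K ->
  (forall x : 'cV_(n + n), K *m x = 0 -> x = 0) ->
  exists (P : 'M[R]_(n + n)) (e : 'rV[R]_n), [/\ P^T *m P = 1%:M,
    forall i, 0 < e 0 i &
    P^T *m K *m P = block_mx 0 (diag_mx e) (- diag_mx e) 0].
Proof.
elim: n K => [|n IH] K Kskew Kinj.
  by exists 1%:M, 0; split; try (by case); apply/matrixP; case.
have [a [v [w [[a0 v1 w1 vw] [Kv Kw]]]]] := skew_eigenplane Kskew Kinj.
(* [(1 + n) + (1 + n)] is convertible to [n.+1 + n.+1], and exposes the
   position of the eigenplane inside each of the four blocks. *)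
pose i0 : 'I_((1 + n) + (1 + n)) := lshift _ (lshift _ 0).
pose j0 : 'I_((1 + n) + (1 + n)) := rshift _ (lshift _ 0).
have [//|P [PP Pv Pw Pi Pj]] := orthonormal_pair_frame (i := i0) (j := j0) _ v1 w1 vw.
have PP' : P *m P^T = 1%:M by apply: mulmx1C.
have [N NPK] : exists N : 'M_((1 + n) + (1 + n)), N = P *m K *m P^T by eexists.
have Nskew : N^T = - N.
  by rewrite NPK !trmx_mul trmxK Kskew mulNmx mulmxN mulmxA.
have Ninj (x : 'cV_((1 + n) + (1 + n))) : N *m x = 0 -> x = 0.
  move/(congr1 (mulmx P^T)); rewrite NPK !mulmxA PP mul1mx mulmx0 -mulmxA => /Kinj.
  by move/(congr1 (mulmx P)); rewrite mulmxA PP' mul1mx mulmx0.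
have Ni x : N x i0 = - a * (x == j0)%:R.
  have : N *m delta_mx i0 0 = - a *: delta_mx j0 0 :> 'cV_(_ + _).
    by rewrite NPK -!mulmxA Pi Kv -scalemxAr Pw.
  by move/matrixP/(_ x 0); rewrite -colE !mxE andbT.
have Nj x : N x j0 = a * (x == i0)%:R.
  have : N *m delta_mx j0 0 = a *: delta_mx i0 0 :> 'cV_(_ + _).
    by rewrite NPK -!mulmxA Pj Kw -scalemxAr Pv.
  by move/matrixP/(_ x 0); rewrite -colE !mxE andbT.
have Nsw x y : N x y = - N y x by move/matrixP/(_ y x): Nskew; rewrite !mxE.
pose p := drsubmx (ulsubmx N); pose q := drsubmx (ursubmx N).
pose r := drsubmx (dlsubmx N); pose s := drsubmx (drsubmx N).
have NE : N = block_mx (block_mx 0 0 0 p) (block_mx a%:M 0 0 q)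
                       (block_mx (- a)%:M 0 0 r) (block_mx 0 0 0 s).
  rewrite -[LHS]submxK; congr block_mx; rewrite -[LHS]submxK; congr block_mx => //;
    apply/matrixP => x y;
    rewrite ?ord1 !mxE -/i0 -/j0 ?Ni ?Nj ?[N i0 _]Nsw ?[N j0 _]Nsw ?Ni ?Nj;
    by rewrite ?eqxx /i0 /j0 ?eq_shift ?(mulr1, mulr0, oppr0, opprK).
have [|x|Q [e [QQ e0 QK]]] := IH (block_mx p q r s).
- move: Nskew; rewrite NE !tr_block_mx !opp_block_mx => /eq_block_mx[].
  by move=> /eq_block_mx[_ _ _ ->] /eq_block_mx[_ _ _ ->]
     /eq_block_mx[_ _ _ ->] /eq_block_mx[_ _ _ ->].
- rewrite -[x]vsubmxK mul_block_col -[0 in RHS]vsubmxK => /eq_col_mx[].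
  set y := usubmx x; set z := dsubmx x; rewrite !linear0 => yz1 yz2.
  have : N *m col_mx (col_mx 0 y) (col_mx 0 z) = 0.
    rewrite NE mul_block_col !mul_block_col !(mul0mx, mulmx0, add0r, addr0).
    by rewrite !add_col_mx !addr0 yz1 yz2 !col_mx0.
  move/Ninj; rewrite -[0 in RHS]vsubmxK => /eq_col_mx[].
  rewrite !linear0 -[0 in RHS]vsubmxK => /eq_col_mx[_ ->].
  rewrite -[0 in RHS]vsubmxK => /eq_col_mx[_ ->].
  by rewrite !linear0 col_mx0.
pose Q1 := ulsubmx Q; pose Q2 := ursubmx Q; pose Q3 := dlsubmx Q; pose Q4 := drsubmx Q.
have QE : Q = block_mx Q1 Q2 Q3 Q4 by rewrite submxK.
pose B : 'M_((1 + n) + (1 + n)) :=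
  block_mx (block_mx 1%:M 0 0 Q1) (block_mx 0 0 0 Q2)
           (block_mx 0 0 0 Q3) (block_mx 1%:M 0 0 Q4).
have BT : B^T = block_mx (block_mx 1%:M 0 0 Q1^T) (block_mx 0 0 0 Q3^T)
                         (block_mx 0 0 0 Q2^T) (block_mx 1%:M 0 0 Q4^T).
  by rewrite !tr_block_mx !trmx0 !trmx1.
have BB : B^T *m B = 1%:M.
  move: QQ; rewrite QE tr_block_mx mulmx_block scalar_mx_block.
  move=> /eq_block_mx[q1 q2 q3 q4].
  rewrite BT !mulmx_block !(mulmx0, mul0mx, addr0, add0r, mulmx1, mul1mx).
  rewrite !add_block_mx !(addr0, add0r) q1 q2 q3 q4.
  by rewrite !block_mx0 -!scalar_mx_block.
have BN : B^T *m N *m B = block_mx 0 (diag_mx (row_mx a%:M e))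
                          (- diag_mx (row_mx a%:M e)) 0.
  move: QK; rewrite QE tr_block_mx !mulmx_block => /eq_block_mx[q1 q2 q3 q4].
  rewrite BT NE !mulmx_block !(mulmx0, mul0mx, addr0, add0r, mulmx1, mul1mx).
  rewrite !add_block_mx !(mulmx_block, mulmx0, mul0mx, addr0, add0r, mulmx1, mul1mx).
  rewrite !add_block_mx !(addr0, add0r) q1 q2 q3 q4.
  rewrite !block_mx0 diag_mx_row opp_block_mx !oppr0.
  have -> : diag_mx a%:M = a%:M :> 'M_1 by apply/matrixP => ? ?; rewrite !ord1 !mxE.
  by rewrite raddfN.
exists (P^T *m B), (row_mx a%:M e : 'rV_(1 + n)); split.
- by rewrite trmx_mul trmxK -mulmxA (mulmxA P) PP' mul1mx.
- move=> i; rewrite mxE; case: split_ordP => k _ //.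
  by rewrite !ord1 !mxE eqxx.
by rewrite trmx_mul trmxK -BN NPK !mulmxA.
Qed.

End Skew.

(** * The symplectic group *)

Section Symplectic.
Variables (R : realType) (n : nat).
Implicit Types (A S : 'M[R]_(n + n)) (d : 'rV[R]_n).

Lemma Sm_trmx m (A : 'M[R]_m) : Sm A -> A^T = A.
Proof.
rewrite /Sm /= is_hermitianmxE => /eqP {2}->.
by rewrite expr0 scale1r map_mx_id.
Qed.

Lemma diag2E d : diag2 d = diag_mx (row_mx d d).
Proof. by rewrite diag_mx_row. Qed.

Lemma tr_J : (J R n)^T = - J R n.
Proof. by rewrite /J tr_block_mx opp_block_mx !trmx0 linearN /= trmx1 !oppr0 opprK. Qed.

Lemma mulJJ : J R n *m J R n = - 1%:M.
Proof.
rewrite /J mulmx_block !(mulmx0, mul0mx, addr0, add0r, mulmx1, mul1mx).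
by rewrite scalar_mx_block opp_block_mx !oppr0.
Qed.

Lemma mul_trJJ : (J R n)^T *m J R n = 1%:M.
Proof. by rewrite tr_J mulNmx mulJJ opprK. Qed.

Lemma mulJ_trJ : J R n *m (J R n)^T = 1%:M.
Proof. by rewrite tr_J mulmxN mulJJ opprK. Qed.

Lemma J_diag2 d : J R n *m diag2 d = diag2 d *m J R n.
Proof.
rewrite /J /diag2 !mulmx_block.
by rewrite !(mulmx0, mul0mx, addr0, add0r, mulmx1, mul1mx, mulmxN, mulNmx).
Qed.

Lemma Sp_left_inverse S : Sp S -> (J R n)^T *m S^T *m J R n *m S = 1%:M.
Proof. by rewrite /Sp /= -!mulmxA => ->; rewrite mul_trJJ. Qed.

Lemma Sp_unitmx S : Sp S -> S \in unitmx.
Proof. by move=> /Sp_left_inverse/mulmx1_unit[]. Qed.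

Lemma Sp_invmxE S : Sp S -> invmx S = (J R n)^T *m S^T *m J R n.
Proof.
move=> hS; have := congr1 (mulmx^~ (invmx S)) (Sp_left_inverse hS).
by rewrite mul1mx mulmxK ?Sp_unitmx.
Qed.

Lemma SpM S1 S2 : Sp S1 -> Sp S2 -> Sp (S1 *m S2).
Proof.
rewrite /Sp /= => h1 h2.
by rewrite trmx_mul -[RHS]h2 -[in RHS]h1 !mulmxA.
Qed.

(** The transpose of a symplectic matrix is symplectic: move the left inverse
[J^T S^T J] of [S] to the right of [S]. *)
Lemma Sp_trmx S : Sp S -> S *m J R n *m S^T = J R n.
Proof.
move=> /Sp_left_inverse/mulmx1C; rewrite tr_J !mulmxA mulmxN !mulNmx.
move=> /(congr1 (mulmx^~ (J R n))).
by rewrite mulNmx -(mulmxA _ (J R n) (J R n)) mulJJ mulmxN mulmx1 opprK mul1mx.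
Qed.

Lemma Sp_invmx S : Sp S -> Sp (invmx S).
Proof.
move=> hS; rewrite /Sp /= Sp_invmxE// !trmx_mul !trmxK.
transitivity ((J R n)^T *m (S *m J R n *m (J R n *m (J R n)^T) *m S^T) *m J R n).
  by rewrite !mulmxA.
by rewrite mulJ_trJ mulmx1 (Sp_trmx hS) mul_trJJ mul1mx.
Qed.

End Symplectic.

(** * Williamson's theorem *)

Section Williamson.
Variables (R : realType).

Definition inv_sqrt m (f : 'rV[R]_m) : 'rV[R]_m := \row_k (Num.sqrt (f 0 k))^-1.

Lemma diag_inv_sqrt m (f : 'rV[R]_m) : (forall k, 0 < f 0 k) ->
  diag_mx (inv_sqrt f) *m diag_mx f *m diag_mx (inv_sqrt f) = 1%:M.
Proof.
move=> f0; rewrite !mulmx_diag -diag_const_mx; congr diag_mx.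
apply/rowP => k; rewrite !mxE.
have s0 : Num.sqrt (f 0 k) != 0 by rewrite gt_eqF// sqrtr_gt0.
by rewrite -{2}[f 0 k]sqr_sqrtr ?(ltW (f0 _))//; field.
Qed.

(** Rescaling an orthonormal eigenbasis of [A] makes it [A]-orthonormal. *)
Lemma Pd_congruence_identity m (A : 'M[R]_m) : Pd A ->
  exists2 C : 'M[R]_m, C \in unitmx & C^T *m A *m C = 1%:M.
Proof.
case=> /Sm_trmx Asym Apos; have [Q [g [QQ AE]]] := symmetric_spectral Asym.
have g_gt0 k : 0 < g 0 k.
  have <- : ((col k Q)^T *m A *m col k Q) 0 0 = g 0 k.
    rewrite colE trmx_mul trmx_delta.
    transitivity ((delta_mx 0 k *m diag_mx g *m delta_mx k 0) (0 : 'I_1) (0 : 'I_1)).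
      congr (_ 0 0); rewrite AE !mulmxA -(mulmxA _ Q^T Q) QQ mulmx1.
      by rewrite -(mulmxA _ Q^T Q) QQ mulmx1.
    by rewrite -rowE -colE !mxE eqxx.
  apply: Apos; apply: contraTneq isT => /(congr1 (mulmx Q^T)).
  rewrite mulmx0 colE mulmxA QQ mul1mx => /matrixP/(_ k 0).
  by rewrite !mxE !eqxx => /eqP; rewrite oner_eq0.
pose h := inv_sqrt g; have hh := diag_inv_sqrt g_gt0.
have CAC : (Q *m diag_mx h)^T *m A *m (Q *m diag_mx h) = 1%:M.
  rewrite AE trmx_mul tr_diag_mx !mulmxA -(mulmxA _ Q^T Q) QQ mulmx1.
  by rewrite -(mulmxA _ Q^T Q) QQ mulmx1.
exists (Q *m diag_mx h) => //.
by have [] := mulmx1_unit CAC.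
Qed.

Lemma sorting_perm n (d : 'rV[R]_n) :
  exists s : 'S_n, forall i j : 'I_n, (i <= j)%N -> d 0 (s i) <= d 0 (s j).
Proof.
pose t := [tuple d 0 i | i < n].
have /tuple_permP[s st] : perm_eq (sort <=%R t) t by rewrite perm_sort.
exists s => i j ij.
have nE (k : 'I_n) : nth 0 (sort <=%R t) k = d 0 (s k).
  by rewrite st -tnth_nth !tnth_mktuple.
rewrite -!nE; apply: (sorted_leq_nth le_trans le_refl) => //.
- exact/sort_sorted/le_total.
- by rewrite inE size_sort size_tuple.
- by rewrite inE size_sort size_tuple.
Qed.

(** Let [C] be an [A]-orthonormal basis.  An orthogonal change of basis keeps
[A] equal to the identity and brings the skew form [C^T J C] to its canonical
form with parameters [e]; scaling each canonical pair by [e^(-1/2)] turns this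
form into [J] and [A] into the diagonal of the [e^-1].  A permutation applied to
both halves sorts the diagonal. *)
Theorem williamson n (A : 'M[R]_(n + n)) : Pd A -> exists d, williamson_spectrum A d.
Proof.
move=> /Pd_congruence_identity[C Cunit CAC].
have [||P [e [PP e_gt0 PKP]]] := @skew_canonical R n (C^T *m J R n *m C).
- by rewrite !trmx_mul trmxK tr_J mulNmx mulmxN mulmxA.
- move=> x Kx; have JCx : J R n *m (C *m x) = 0.
    have CTunit : C^T \in unitmx by rewrite unitmx_tr.
    rewrite -[LHS](mulKmx CTunit).
    have -> : C^T *m (J R n *m (C *m x)) = 0 by rewrite -Kx !mulmxA.
    by rewrite mulmx0.
  have Cx : C *m x = 0 by rewrite -[LHS]mul1mx -mul_trJJ -mulmxA JCx mulmx0.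
  by rewrite -[x](mulKmx Cunit) Cx mulmx0.
have [s s_sorted] := sorting_perm (\row_k (e 0 k)^-1).
pose d := \row_k (e 0 (s k))^-1.
pose W : 'M[R]_(n + n) := block_mx (perm_mx s)^T 0 0 (perm_mx s)^T.
pose h := inv_sqrt e; have heh := diag_inv_sqrt e_gt0.
have h2 : diag_mx h *m diag_mx h = diag_mx (\row_k (e 0 k)^-1).
  rewrite mulmx_diag; congr diag_mx; apply/rowP => k; rewrite !mxE.
  by rewrite -invfM -expr2 sqr_sqrtr// ltW.
have permC (f : 'rV[R]_n) :
    perm_mx s *m diag_mx f *m (perm_mx s)^T = diag_mx (\row_k f 0 (s k)).
  rewrite tr_perm_mx -row_permE -col_permE; apply/matrixP => i j.
  by rewrite !mxE (inj_eq perm_inj).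
exists d; split=> [i|i j ij|]; first by rewrite mxE invr_gt0.
  by have := s_sorted i j ij; rewrite !mxE.
pose S := C *m P *m diag2 h *m W.
have WT : W^T = block_mx (perm_mx s) 0 0 (perm_mx s).
  by rewrite tr_block_mx !trmx0 !trmxK.
have perm1 : perm_mx s *m (perm_mx s)^T = 1%:M :> 'M[R]_n.
  by rewrite tr_perm_mx -perm_mxM mulgV perm_mx1.
have hT : (diag2 h)^T = diag2 h by rewrite diag2E tr_diag_mx.
have conjS (M : 'M[R]_(n + n)) : S^T *m M *m S =
    W^T *m (diag2 h *m (P^T *m (C^T *m M *m C) *m P) *m diag2 h) *m W.
  by rewrite /S !trmx_mul hT !mulmxA.
exists S; rewrite /Sp /= conjS.
  rewrite PKP WT /W /diag2 !mulmx_block !(mulmx0, mul0mx, addr0, add0r).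
  by rewrite mulmxN mulNmx heh !(mulmxN, mulNmx, mulmx1) perm1.
rewrite CAC mulmx1 PP mulmx1 WT /W /diag2 !mulmx_block !(mulmx0, mul0mx, addr0, add0r).
rewrite h2 permC; congr block_mx; congr diag_mx; apply/rowP => k; by rewrite !mxE.
Qed.

Lemma symplectic_eigenvaluesP n (A : 'M[R]_(n + n)) : Pd A ->
  williamson_spectrum A (symplectic_eigenvalues A).
Proof. by move=> /williamson[d dA]; apply: (xgetPex 0); exists d. Qed.

End Williamson.

(** * The entrywise l1 norm and the spectral norm *)

Section L1norm.
Variable R : realType.

Definition mxl1 m p (M : 'M[R]_(m, p)) : R := \sum_i \sum_j `|M i j|.

Lemma mxl1_ge0 m p (M : 'M[R]_(m, p)) : 0 <= mxl1 M.
Proof. by apply: sumr_ge0 => i _; apply: sumr_ge0. Qed.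

Lemma mxl1_entry m p (M : 'M[R]_(m, p)) i j : `|M i j| <= mxl1 M.
Proof.
rewrite /mxl1 (bigD1 i)//= (bigD1 j)//= -addrA lerDl addr_ge0//.
  exact: sumr_ge0.
by apply: sumr_ge0 => k _; apply: sumr_ge0.
Qed.

Lemma mxl1_le m p (M : 'M[R]_(m, p)) b :
  (forall i j, `|M i j| <= b) -> mxl1 M <= m%:R * p%:R * b.
Proof.
move=> Mb; have -> : m%:R * p%:R * b = \sum_(i < m) \sum_(j < p) b.
  by rewrite !sumr_const !card_ord -mulrA mulr_natl mulr_natl.
by apply: ler_sum => i _; apply: ler_sum => j _.
Qed.

Lemma mxl1D m p (M N : 'M[R]_(m, p)) : mxl1 (M + N) <= mxl1 M + mxl1 N.
Proof.
rewrite /mxl1 -big_split; apply: ler_sum => i _; rewrite -big_split.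
by apply: ler_sum => j _; rewrite mxE ler_normD.
Qed.

Lemma mxl1N m p (M : 'M[R]_(m, p)) : mxl1 (- M) = mxl1 M.
Proof. by apply: eq_bigr => i _; apply: eq_bigr => j _; rewrite mxE normrN. Qed.

Lemma mxl1Z m p a (M : 'M[R]_(m, p)) : mxl1 (a *: M) = `|a| * mxl1 M.
Proof.
rewrite /mxl1 mulr_sumr; apply: eq_bigr => i _; rewrite mulr_sumr.
by apply: eq_bigr => j _; rewrite mxE normrM.
Qed.

Lemma mxl1_trmx m p (M : 'M[R]_(m, p)) : mxl1 M^T = mxl1 M.
Proof.
rewrite /mxl1 exchange_big; apply: eq_bigr => i _; apply: eq_bigr => j _.
by rewrite mxE.
Qed.

Lemma mxl1M m p q (M : 'M[R]_(m, p)) (N : 'M[R]_(p, q)) :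
  mxl1 (M *m N) <= mxl1 M * mxl1 N.
Proof.
apply: (@le_trans _ _ (\sum_i \sum_j \sum_k `|M i k| * `|N k j|)).
  apply: ler_sum => i _; apply: ler_sum => j _; rewrite mxE.
  by apply: le_trans (ler_norm_sum _ _ _) _; apply: ler_sum => k _; rewrite normrM.
rewrite /mxl1 mulr_suml; apply: ler_sum => i _.
rewrite exchange_big /= mulr_suml; apply: ler_sum => k _.
rewrite -mulr_sumr ler_wpM2l// (bigD1 k)//= lerDl.
by apply: sumr_ge0 => l _; apply: sumr_ge0.
Qed.

Lemma mxl1_eq0 m p (M : 'M[R]_(m, p)) : mxl1 M = 0 -> M = 0.
Proof.
move=> M0; apply/matrixP => i j; rewrite mxE; apply/eqP.
by rewrite -normr_le0 -M0 mxl1_entry.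
Qed.

(** Any submultiplicative norm bounds the modulus of the eigenvalues. *)
Lemma mxl1_eigen m (M : 'M[R]_m) a (v : 'cV[R]_m) :
  v != 0 -> M *m v = a *: v -> `|a| <= mxl1 M.
Proof.
move=> v0 Mv; have v_gt0 : 0 < mxl1 v.
  by rewrite lt_def mxl1_ge0 andbT; apply: contra v0 => /eqP/mxl1_eq0->.
by rewrite -(ler_pM2r v_gt0) -mxl1Z -Mv mxl1M.
Qed.

Lemma singular_value_le m (M : 'M[R]_m) s : singular_value M s -> s <= mxl1 M.
Proof.
case=> s0 /eigenvalueP[v vM v0].
have /mxl1_eigen : v^T != 0 by rewrite trmx_eq0.
move=> /(_ (M^T *m M)^T (s ^+ 2)); rewrite -trmx_mul vM linearZ => /(_ erefl).
rewrite mxl1_trmx ger0_norm ?sqr_ge0// => s2.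
rewrite -(ler_pXn2r (n := 2))// ?nnegrE ?mxl1_ge0//.
by apply: le_trans s2 _; apply: le_trans (mxl1M _ _) _; rewrite mxl1_trmx expr2.
Qed.

Lemma spectral_norm_ge0 m (M : 'M[R]_m) : 0 <= spectral_norm M.
Proof.
have [[s sM]|/set0P/negP/negPn/eqP e] := pselect ([set s | singular_value M s] !=set0).
  apply: (@le_trans _ _ s); first by case: sM.
  by apply: ub_le_sup => //; exists (mxl1 M) => r; apply: singular_value_le.
by rewrite /spectral_norm e sup0.
Qed.

Lemma spectral_norm_le_mxl1 m (M : 'M[R]_m) : spectral_norm M <= mxl1 M.
Proof.
have [ne|/set0P/negP/negPn/eqP e] := pselect ([set s | singular_value M s] !=set0).
  by apply: ge_sup => // s; apply: singular_value_le.
by rewrite /spectral_norm e sup0 mxl1_ge0.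
Qed.

(** [`|M i j| ^+ 2] is at most the diagonal entry [(M^T M) j j], which is a
convex combination of the eigenvalues of [M^T M], all of them squares of
singular values. *)
Lemma entry_le_spectral_norm m (M : 'M[R]_m) i j : `|M i j| <= spectral_norm M.
Proof.
have [|Q [g [QQ MQ]]] := @symmetric_spectral _ _ (M^T *m M).
  by rewrite trmx_mul trmxK.
have QQ' : Q *m Q^T = 1%:M by apply: mulmx1C.
have gE k : g 0 k = dot (col k (M *m Q)) (col k (M *m Q)).
  have : (M *m Q)^T *m (M *m Q) = diag_mx g.
    by rewrite trmx_mul -mulmxA (mulmxA M^T) MQ !mulmxA QQ mul1mx -mulmxA QQ mulmx1.
  move=> /matrixP/(_ k k); rewrite dotE [in RHS]mxE eqxx mulr1n => <-.
  by rewrite mxE; apply: eq_bigr => l _; rewrite !mxE.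
have g_ge0 k : 0 <= g 0 k by rewrite gE dot_ge0.
have gs k : Num.sqrt (g 0 k) <= spectral_norm M.
  apply: ub_le_sup; first by exists (mxl1 M) => s; apply: singular_value_le.
  split; first exact: sqrtr_ge0.
  apply/eigenvalueP; exists (delta_mx 0 k *m Q^T).
    rewrite MQ sqr_sqrtr// !mulmxA -(mulmxA _ Q^T Q) QQ mulmx1 scalemxAl.
    congr (_ *m _); apply/matrixP => a b; rewrite !ord1 -rowE !mxE eqxx /=.
    case: eqP => [->|]; rewrite ?eqxx ?mulr1// => /eqP kb.
    by rewrite eq_sym (negbTE kb) mulr0.
  apply: contraTneq isT => /(congr1 (mulmx^~ Q)); rewrite -mulmxA QQ mulmx1 mul0mx.
  by move=> /matrixP/(_ 0 k); rewrite !mxE !eqxx => /eqP; rewrite oner_eq0.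
have s0 : 0 <= spectral_norm M by apply: le_trans (gs j); apply: sqrtr_ge0.
rewrite -(ler_pXn2r (n := 2))// ?nnegrE// real_normK ?num_real//.
have -> : spectral_norm M ^+ 2 = \sum_k spectral_norm M ^+ 2 * Q j k ^+ 2.
  rewrite -mulr_sumr; have /matrixP/(_ j j) := QQ'.
  rewrite !mxE eqxx => Qj; rewrite -[LHS]mulr1 -[1]Qj; congr (_ * _).
  by apply: eq_bigr => k _; rewrite mxE expr2.
apply: (@le_trans _ _ ((M^T *m M) j j)).
  rewrite mxE (bigD1 i)//= mxE expr2 lerDl; apply: sumr_ge0 => k _.
  by rewrite mxE -expr2 sqr_ge0.
rewrite MQ mxE; apply: ler_sum => k _.
rewrite mul_mx_diag !mxE mulrAC -expr2 mulrC ler_wpM2r ?sqr_ge0//.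
by rewrite -[g 0 k]sqr_sqrtr// ler_pXn2r// nnegrE ?sqrtr_ge0.
Qed.

Lemma mxl1_le_spectral_norm m (M : 'M[R]_m) :
  mxl1 M <= m%:R * m%:R * spectral_norm M.
Proof. by apply: mxl1_le => i j; apply: entry_le_spectral_norm. Qed.

End L1norm.

(** * Monotonicity of symplectic eigenvalues *)

Section MinMax.
Variables (R : realType) (n : nat).

(** The symplectic pair to which a coordinate belongs: both [k] and [n + k] are
sent to [k]. *)
Definition mode (l : 'I_(n + n)) : 'I_n :=
  match fintype.split l with inl k => k | inr k => k end.

Lemma mode_lshift k : mode (lshift n k) = k.
Proof. by rewrite /mode (unsplitK (inl k)). Qed.

Lemma diag2_mode (d : 'rV[R]_n) : diag2 d = diag_mx (\row_l d 0 (mode l)).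
Proof.
rewrite diag2E; congr diag_mx; apply/rowP => l; rewrite !mxE /mode.
by case: fintype.split.
Qed.

Lemma mul_mx_diag2E p (u : 'M[R]_(p, n + n)) d i l :
  (u *m diag2 d) i l = u i l * d 0 (mode l).
Proof. by rewrite diag2_mode mul_mx_diag !mxE. Qed.

Lemma dot_diag m (f : 'rV[R]_m) (x : 'cV[R]_m) :
  dot x (diag_mx f *m x) = \sum_l f 0 l * x l 0 ^+ 2.
Proof.
rewrite dotE; apply: eq_bigr => l _; rewrite mul_diag_mx mxE; by ring.
Qed.

Lemma williamson_congruence (A S : 'M[R]_(n + n)) d : Sp S ->
  S^T *m A *m S = diag2 d -> A = (invmx S)^T *m diag2 d *m invmx S.
Proof.
move=> hS <-; rewrite !mulmxA -trmx_mul -(mulmxA _ S) mulmxV ?Sp_unitmx// mulmx1.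
by rewrite trmx1 mul1mx.
Qed.

(** Conjugating [A] by [J] and inverting [A] are both diagonalized by the same
vectors [S^T x], with reciprocal weights.  The squares of the symplectic
eigenvalues are thus the eigenvalues of a symmetric pencil, to which the
Courant-Fischer argument applies. *)
Lemma williamson_conjJ (A S : 'M[R]_(n + n)) d : Sp S ->
  S^T *m A *m S = diag2 d -> (J R n)^T *m A *m J R n = S *m diag2 d *m S^T.
Proof.
move=> hS /(williamson_congruence hS)->; rewrite Sp_invmxE// !trmx_mul !trmxK.
transitivity ((J R n *m J R n)^T *m S *m (J R n *m diag2 d *m (J R n)^T) *m
              S^T *m (J R n *m J R n)).
  by rewrite trmx_mul !mulmxA.
rewrite mulJJ J_diag2 -(mulmxA (diag2 d)) mulJ_trJ mulmx1.
by rewrite [X in X *m S]linearN /= trmx1 mulNmx mul1mx mulmxN mulmx1 !mulNmx opprK.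
Qed.

(** The conditions number [2 j + 2 (n - 1 - j) = 2 n - 2], fewer than the
dimension.  They are the equations [x^T M = 0] for a single square matrix [M]
whose column [j] vanishes. *)
Lemma complementary_modes_meet (S T : 'M[R]_(n + n)) (j : 'I_n) :
  exists2 x : 'cV[R]_(n + n), x != 0 &
    (forall l, (mode l < j)%N -> (S^T *m x) l 0 = 0) /\
    (forall l, (j < mode l)%N -> (T^T *m x) l 0 = 0).
Proof.
pose low := \row_(k < n) ((k < j)%N%:R : R).
pose high := \row_(k < n) ((j < k)%N%:R : R).
pose M := S *m diag2 low + T *m diag2 high.
have Mj : M *m delta_mx (lshift n j) 0 = 0 :> 'cV_(n + n).
  rewrite mulmxDl -!mulmxA -!colE.
  have lowj : col (lshift n j) (diag2 low) = 0.
    apply/matrixP => k i; rewrite diag2_mode mxE mxE.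
    case: eqP => [->|_]; last by rewrite mulr0n mxE.
    by rewrite !mxE mode_lshift ltnn.
  have highj : col (lshift n j) (diag2 high) = 0.
    apply/matrixP => k i; rewrite diag2_mode mxE mxE.
    case: eqP => [->|_]; last by rewrite mulr0n mxE.
    by rewrite !mxE mode_lshift ltnn.
  by rewrite lowj highj !mulmx0 addr0.
have /eqP/det0P[v v0 vM] : \det M = 0.
  apply/eqP/negPn/negP => dM; have Mu : M \in unitmx by rewrite unitmxE unitfE.
  have := congr1 (mulmx (invmx M)) Mj; rewrite mulKmx// mulmx0.
  by move=> /matrixP/(_ (lshift n j) 0); rewrite !mxE !eqxx => /eqP; rewrite oner_eq0.
exists v^T; first by rewrite trmx_eq0.
have vl l : (v *m S) 0 l * low 0 (mode l) + (v *m T) 0 l * high 0 (mode l) = 0.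
  move/matrixP/(_ 0 l): vM; rewrite mulmxDr !mulmxA mxE !mul_mx_diag2E => ->.
  by rewrite mxE.
split=> l hl; rewrite -trmx_mul mxE; have := vl l;
  rewrite [low _ _]mxE [high _ _]mxE hl.
  by rewrite ltnNge (ltnW hl) /= mulr1 mulr0 addr0.
by rewrite ltnNge (ltnW hl) /= mulr1 mulr0 add0r.
Qed.

(** Courant-Fischer for the pencil of [J^T A J] and [A^-1], whose eigenvalues
are the [a k ^+ 2], each with multiplicity two.  On a vector [x] supported by
the modes [>= j] of [A] and by the modes [<= j] of [B],
[a j ^+ 2 * p <= x^T J^T A J x <= t x^T J^T B J x <= t * b j ^+ 2 * q], where
[p = x^T A^-1 x] and [q = x^T B^-1 x] satisfy [q <= t * p] because inversion
reverses the order of positive definite forms. *)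
Lemma symplectic_minmax (A B S T : 'M[R]_(n + n)) (a b : 'rV[R]_n) t :
  0 < t -> Sp S -> Sp T ->
  S^T *m A *m S = diag2 a -> T^T *m B *m T = diag2 b ->
  (forall i, 0 < a 0 i) -> (forall i, 0 < b 0 i) ->
  (forall i j : 'I_n, (i <= j)%N -> a 0 i <= a 0 j) ->
  (forall i j : 'I_n, (i <= j)%N -> b 0 i <= b 0 j) ->
  (forall x, dot x (A *m x) <= t * dot x (B *m x)) ->
  forall j, a 0 j <= t * b 0 j.
Proof.
move=> t0 hS hT SA TB a0 b0 a_sorted b_sorted AB j.
have [x x0 [xS xT]] := complementary_modes_meet S T j.
have [y yE] : exists y, y = S^T *m x by eexists.
have [z zE] : exists z, z = T^T *m x by eexists.
pose inv (d : 'rV[R]_n) := \row_k (d 0 k)^-1.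
pose p := dot y (diag2 (inv a) *m y); pose q := dot z (diag2 (inv b) *m z).
have STunit : (invmx S)^T *m S^T = 1%:M by rewrite -trmx_mul mulmxV ?Sp_unitmx// trmx1.
have p_gt0 : 0 < p.
  have : y != 0.
    apply: contraNneq x0 => y0.
    by rewrite -[x]mul1mx -STunit -mulmxA -yE y0 mulmx0.
  rewrite /p diag2_mode dot_diag -dot_eq0 dotE => yy.
  rewrite lt_def sumr_ge0 ?andbT => [|l _]; last first.
    by rewrite !mxE mulr_ge0 ?sqr_ge0// invr_ge0 ltW.
  apply: contra yy; rewrite !psumr_eq0 => [/allP h|l _|l _].
  - apply/allP => l /h /=; rewrite !mxE mulf_eq0 invr_eq0 gt_eqF//= sqrf_eq0 => /eqP->.
  - by rewrite -expr2 sqr_ge0.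
  - by rewrite !mxE mulr_ge0 ?sqr_ge0// invr_ge0 ltW.
have lowA : a 0 j ^+ 2 * p <= dot y (diag2 a *m y).
  rewrite /p !diag2_mode !dot_diag mulr_sumr; apply: ler_sum => l _; rewrite !mxE.
  have [/xS yl|jl] := ltnP (mode l) j; first by rewrite yE yl expr0n !mulr0.
  rewrite mulrA ler_wpM2r ?sqr_ge0// ler_pdivrMr// -expr2.
  by rewrite ler_pXn2r// ?nnegrE ?(ltW (a0 _))// a_sorted.
have highB : dot z (diag2 b *m z) <= b 0 j ^+ 2 * q.
  rewrite /q !diag2_mode !dot_diag mulr_sumr; apply: ler_sum => l _; rewrite !mxE.
  have [/xT zl|jl] := ltnP j (mode l); first by rewrite zE zl expr0n !mulr0.
  rewrite mulrA ler_wpM2r ?sqr_ge0// ler_pdivlMr// -expr2.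
  by rewrite ler_pXn2r// ?nnegrE ?(ltW (b0 _))// b_sorted.
have conjJ : dot y (diag2 a *m y) <= t * dot z (diag2 b *m z).
  have := AB (J R n *m x); rewrite !dot_mulmxl !mulmxA.
  rewrite (williamson_conjJ hS SA) (williamson_conjJ hT TB).
  by rewrite yE zE !dot_mulmxl !trmxK !mulmxA.
have qp : q <= t * p.
  have invK (d : 'rV[R]_n) : (forall i, 0 < d 0 i) -> diag2 d *m diag2 (inv d) = 1%:M.
    move=> d0; rewrite !diag2_mode mulmx_diag; apply/matrixP => k l; rewrite !mxE.
    by rewrite divff// gt_eqF.
  have inverse (C U : 'M[R]_(n + n)) d : Sp U -> U^T *m C *m U = diag2 d ->
      (forall i, 0 < d 0 i) -> C *m (U *m diag2 (inv d) *m U^T) = 1%:M.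
    move=> hU UC d0; rewrite (williamson_congruence hU UC) !mulmxA.
    rewrite -(mulmxA _ (invmx U) U) mulVmx ?Sp_unitmx// mulmx1.
    rewrite -(mulmxA _ (diag2 d)) invK// mulmx1.
    by rewrite -trmx_mul mulmxV ?Sp_unitmx// trmx1.
  pose u := S *m diag2 (inv a) *m S^T *m x.
  pose w := T *m diag2 (inv b) *m T^T *m x.
  have Au : A *m u = x by rewrite /u mulmxA (inverse _ _ _ hS SA a0) mul1mx.
  have Bw : B *m w = x by rewrite /w mulmxA (inverse _ _ _ hT TB b0) mul1mx.
  have pE : p = dot x u by rewrite /p yE dot_mulmxl trmxK /u !mulmxA.
  have qE : q = dot x w by rewrite /q zE dot_mulmxl trmxK /w !mulmxA.
  have AE := williamson_congruence hS SA.
  have Asym : A^T = A by rewrite AE !trmx_mul trmxK diag2E tr_diag_mx mulmxA.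
  have A_ge0 v : 0 <= dot v (A *m v).
    rewrite AE -!mulmxA -dot_mulmxl diag2_mode dot_diag.
    by apply: sumr_ge0 => l _; rewrite mxE mulr_ge0 ?sqr_ge0// ltW.
  (* Expanding [0 <= (t u - w)^T A (t u - w)] with [u = A^-1 x] and
     [w = B^-1 x] gives [0 <= t ^+ 2 p - 2 t q + w^T A w], and
     [w^T A w <= t w^T B w = t q]. *)
  have := A_ge0 (t *: u - w); rewrite mulmxBr -scalemxAr Au.
  have uw : dot u (A *m w) = q by rewrite qE -{1}Asym -dot_mulmxl Au.
  rewrite !(dotDl, dotDr, dotNl, dotNr, dotZl, dotZr) uw (dotC w x) (dotC u x) -pE -qE.
  have := AB w; rewrite Bw (dotC w x) -qE => Aw h.
  have : 0 <= t * (t * p - q) by lra.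
  by rewrite pmulr_rge0// subr_ge0.
suff : a 0 j ^+ 2 <= (t * b 0 j) ^+ 2.
  by rewrite ler_pXn2r// nnegrE ?mulr_ge0// ltW.
rewrite -(ler_pM2r p_gt0); apply: le_trans lowA _; apply: le_trans conjJ _.
have -> : (t * b 0 j) ^+ 2 * p = t * (b 0 j ^+ 2 * (t * p)) by ring.
by rewrite ler_pM2l//; apply: le_trans highB _; rewrite ler_wpM2l ?sqr_ge0.
Qed.

End MinMax.

(** * Norm estimates and inverse square roots near the identity *)

Section Bounds.
Variable R : realType.

Lemma mxl1M_le m p q (M : 'M[R]_(m, p)) (N : 'M[R]_(p, q)) a b :
  mxl1 M <= a -> mxl1 N <= b -> mxl1 (M *m N) <= a * b.
Proof.
by move=> Ma Nb; apply: le_trans (mxl1M _ _) _; rewrite ler_pM ?mxl1_ge0.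
Qed.

Lemma mxl1D_le m p (M N : 'M[R]_(m, p)) a b :
  mxl1 M <= a -> mxl1 N <= b -> mxl1 (M + N) <= a + b.
Proof. by move=> Ma Nb; apply: le_trans (mxl1D _ _) _; rewrite lerD. Qed.

Lemma mxl1B_le m p (M N : 'M[R]_(m, p)) a b :
  mxl1 M <= a -> mxl1 N <= b -> mxl1 (M - N) <= a + b.
Proof. by move=> Ma Nb; rewrite mxl1D_le// mxl1N. Qed.

Lemma fin_lower_bound (I : finType) (f : I -> R) :
  (forall i, 0 < f i) -> exists2 b, 0 < b & forall i, b <= f i.
Proof.
move=> f_gt0; have s_ge0 (P : pred I) : 0 <= \sum_(i | P i) (f i)^-1.
  by apply: sumr_ge0 => i _; rewrite invr_ge0 ltW.
have s_gt0 : 0 < 1 + \sum_i (f i)^-1 by rewrite ltr_pwDl.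
exists (1 + \sum_i (f i)^-1)^-1 => [|i]; first by rewrite invr_gt0.
rewrite -[f i]invrK lef_pV2 ?posrE ?invr_gt0// (bigD1 i)//= addrCA lerDl.
by rewrite addr_ge0.
Qed.

Lemma fin_upper_bound (I : finType) (f : I -> R) :
  (forall i, 0 < f i) -> exists2 b, 0 < b & forall i, f i <= b.
Proof.
move=> f_gt0; have s_ge0 (P : pred I) : 0 <= \sum_(i | P i) f i.
  by apply: sumr_ge0 => i _; rewrite ltW.
exists (1 + \sum_i f i) => [|i]; first by rewrite ltr_pwDl.
by rewrite (bigD1 i)//= addrCA lerDl addr_ge0.
Qed.

Lemma quadratic_form_le m (M : 'M[R]_m) (x : 'cV[R]_m) :
  `|dot x (M *m x)| <= mxl1 M * dot x x.
Proof.
rewrite dotE; apply: le_trans (ler_norm_sum _ _ _) _; rewrite /mxl1 mulr_suml.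
apply: ler_sum => i _; rewrite mxE mulr_sumr mulr_suml.
apply: le_trans (ler_norm_sum _ _ _) _; apply: ler_sum => j _.
rewrite mulrCA normrM ler_wpM2l//.
have xk k : x k 0 ^+ 2 <= dot x x.
  rewrite dotE (bigD1 k)//= -expr2 lerDl; apply: sumr_ge0 => l _.
  by rewrite -expr2 sqr_ge0.
have := xk i; have := xk j.
rewrite ler_norml; nra.
Qed.

Lemma mxl1_orthogonal m (Q : 'M[R]_m) : Q *m Q^T = 1%:M ->
  mxl1 Q <= m%:R * m%:R.
Proof.
move=> QQ; rewrite -[leRHS]mulr1; apply: mxl1_le => i j.
rewrite -(ler_pXn2r (n := 2))// ?nnegrE// real_normK ?num_real// expr1n.
have /matrixP/(_ i i) := QQ; rewrite !mxE eqxx mulr1n => <-.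
rewrite (bigD1 j)//= mxE expr2 lerDl; apply: sumr_ge0 => k _.
by rewrite mxE -expr2 sqr_ge0.
Qed.

Lemma inv_sqrt_near1 (g : R) : `|g - 1| <= 2^-1 ->
  0 < g /\ `|(Num.sqrt g)^-1 - 1| <= 2 * `|g - 1|.
Proof.
move=> gh; have g0 : 2^-1 <= g by move: gh; rewrite ler_norml; lra.
have g_gt0 : 0 < g by lra.
split=> //; pose r := Num.sqrt g.
have r0 : 0 < r by rewrite sqrtr_gt0.
have r2 : r ^+ 2 = g by rewrite sqr_sqrtr// ltW.
have r_ge : 2^-1 <= r by nra.
rewrite -/r -r2.
have -> : r^-1 - 1 = (r ^+ 2 - 1) * - (r * (r + 1))^-1.
  have r1 : r + 1 != 0 by rewrite gt_eqF//; lra.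
  have rn0 : r != 0 by rewrite gt_eqF.
  by field; rewrite rn0 r1.
rewrite normrM mulrC ler_wpM2r// normrN ger0_norm ?invr_ge0; last by nra.
by rewrite -[leRHS]invrK lef_pV2 ?posrE; nra.
Qed.

(** The matrix [G^(-1/2)], defined on an eigenbasis of [G].  It commutes with
everything that commutes with [G] because, in that basis, commuting with a
diagonal matrix means vanishing between different eigenvalues, and equal
eigenvalues of [G] give equal eigenvalues of [G^(-1/2)]. *)
Lemma inv_sqrt_near_identity m (G : 'M[R]_m) : G^T = G -> mxl1 (G - 1%:M) <= 2^-1 ->
  exists W : 'M[R]_m, [/\ W^T = W, W *m G *m W = 1%:M,
    forall Z, Z *m G = G *m Z -> Z *m W = W *m Z &
    mxl1 (W - 1%:M) <= m%:R ^+ 6 * 2 * mxl1 (G - 1%:M)].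
Proof.
move=> /symmetric_spectral[Q [g [QQ GE]]] G1.
have QQ' : Q *m Q^T = 1%:M by apply: mulmx1C.
have gk k : `|g 0 k - 1| <= mxl1 (G - 1%:M).
  apply: (@mxl1_eigen _ _ _ _ (Q *m delta_mx k 0)).
    apply: contraTneq isT => /(congr1 (mulmx Q^T)).
    rewrite mulmxA QQ mul1mx mulmx0 => /matrixP/(_ k 0).
    by rewrite !mxE !eqxx => /eqP; rewrite oner_eq0.
  rewrite mulmxBl mul1mx GE -(mulmxA _ Q^T) (mulmxA Q^T) QQ mul1mx -mulmxA.
  rewrite scalerBl scale1r.
  congr (_ - _); rewrite scalemxAr; congr (Q *m _).
  apply/matrixP => i j; rewrite mul_diag_mx !mxE.
  by case: eqP => [->|] //=; rewrite !mulr0.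
have gP k := inv_sqrt_near1 (le_trans (gk k) G1).
pose w := inv_sqrt g.
pose W := Q *m diag_mx w *m Q^T.
exists W; split.
- by rewrite /W !trmx_mul trmxK tr_diag_mx mulmxA.
- rewrite GE /W !mulmxA -(mulmxA _ Q^T Q) QQ mulmx1 -(mulmxA _ Q^T Q) QQ mulmx1.
  have wgw := diag_inv_sqrt (fun k => (gP k).1).
  transitivity (Q *m (diag_mx w *m diag_mx g *m diag_mx w) *m Q^T).
    by rewrite !mulmxA.
  by rewrite wgw mulmx1.
- move=> Z ZG; have [Z' Z'E] : exists Z', Z' = Q^T *m Z *m Q by eexists.
  have ZE : Z = Q *m Z' *m Q^T.
    by rewrite Z'E !mulmxA QQ' mul1mx -mulmxA QQ' mulmx1.
  have Zg : Z' *m diag_mx g = diag_mx g *m Z'.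
    have gE : diag_mx g = Q^T *m G *m Q.
      by rewrite GE !mulmxA QQ mul1mx -mulmxA QQ mulmx1.
    rewrite gE Z'E !mulmxA -(mulmxA _ Q Q^T) QQ' mulmx1 -(mulmxA _ Q Q^T) QQ' mulmx1.
    by rewrite -(mulmxA Q^T Z) ZG mulmxA.
  have Zw : Z' *m diag_mx w = diag_mx w *m Z'.
    apply/matrixP => k l; move/matrixP/(_ k l): Zg.
    rewrite !mul_mx_diag !mul_diag_mx !mxE.
    move=> e; have [->|gkl] := eqVneq (g 0 k) (g 0 l); first by rewrite mulrC.
    have : (g 0 k - g 0 l) * Z' k l = 0 by rewrite mulrBl -e mulrC subrr.
    by move/eqP; rewrite mulf_eq0 subr_eq0 (negbTE gkl) /= => /eqP->; rewrite mulr0 mul0r.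
  rewrite ZE /W !mulmxA -(mulmxA _ Q^T Q) QQ mulmx1 -(mulmxA _ Q^T Q) QQ mulmx1.
  by rewrite -(mulmxA Q) Zw mulmxA.
have -> : W - 1%:M = Q *m (diag_mx w - 1%:M) *m Q^T.
  by rewrite mulmxBr mulmx1 mulmxBl QQ'.
have -> : m%:R ^+ 6 * 2 * mxl1 (G - 1%:M) =
  m%:R * m%:R * (m%:R * m%:R * (2 * mxl1 (G - 1%:M))) * (m%:R * m%:R) by ring.
apply: mxl1M_le; last by rewrite mxl1_trmx mxl1_orthogonal.
apply: mxl1M_le; first exact: mxl1_orthogonal.
apply: mxl1_le => i j; rewrite !mxE; case: eqP => _.
  by rewrite !mulr1n; have [_ h] := gP i; apply: le_trans h _; rewrite ler_wpM2l.
by rewrite !mulr0n subr0 normr0 mulr_ge0// mxl1_ge0.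
Qed.

End Bounds.

(** * Almost commuting with the Hamiltonian matrix *)

Section Commutant.
Variables (R : realType) (n : nat).

(** Stability of the commutant of [K], in two steps.  Writing [F] for the
commutator, [- (K F + F K) = L^2 X - X L^2] has entries
[(d k ^+ 2 - d l ^+ 2) X k l], so that erasing the entries of [X] between
different values of [d] costs [O(F)] and leaves a matrix [X'] that commutes with
[L].  For such an [X'] the commutator with [K] is [(J^T X' - X' J^T) L], so the
average of [X'] and [J^T X' J] is close to [X'], and it commutes with [J]. *)
Lemma near_commutant (d : 'rV[R]_n) : (forall i, 0 < d 0 i) ->
  let K := (J R n)^T *m diag2 d in
  exists2 c, 0 <= c & forall X : 'M[R]_(n + n),
  exists T : 'M[R]_(n + n), [/\ T *m diag2 d = diag2 d *m T,
    T *m J R n = J R n *m T & mxl1 (X - T) <= c * mxl1 (K *m X - X *m K)].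
Proof.
move=> d_gt0 K; set L := diag2 d; set j := J R n.
(* The value [1] on equal entries only makes the family positive, so that it
   has a positive lower bound. *)
pose gap (p : 'I_n * 'I_n) :=
  if d 0 p.1 == d 0 p.2 then 1 else `|d 0 p.1 ^+ 2 - d 0 p.2 ^+ 2|.
have [|gam gam_gt0 gamP] := @fin_lower_bound _ _ gap.
  case=> k l; rewrite /gap /=; case: eqVneq => // kl; rewrite normr_gt0 subr_eq0.
  by rewrite eqrXn2// ?ltW.
pose Li := diag2 (\row_k (d 0 k)^-1).
have LLi : L *m Li = 1%:M.
  rewrite /L /Li !diag2_mode mulmx_diag; apply/matrixP => k l; rewrite !mxE.
  by rewrite divff// gt_eqF.
have jL : j^T *m L = L *m j^T by rewrite tr_J mulNmx mulmxN J_diag2.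
have KK : K *m K = - (L *m L).
  rewrite /K -/L -/j {1}jL -mulmxA (mulmxA j^T) -trmx_mul mulJJ.
  by rewrite [(- 1%:M)^T]linearN /= trmx1 mulNmx mul1mx mulmxN.
pose c1 : R := (n + n)%:R * (n + n)%:R * (2 * mxl1 K / gam).
pose c2 : R := 2^-1 * ((1 + (mxl1 K * c1 + c1 * mxl1 K)) * mxl1 Li * mxl1 j).
have c1_ge0 : 0 <= c1 by rewrite !mulr_ge0 ?mxl1_ge0 ?invr_ge0// ltW.
have c2_ge0 : 0 <= c2.
  by do ?[exact: c1_ge0|exact: mxl1_ge0|apply: addr_ge0|apply: mulr_ge0|rewrite invr_ge0].
exists (c1 + c2); first exact: addr_ge0.
move=> X; set F := K *m X - X *m K.
pose X' := \matrix_(k, l) (X k l * (d 0 (mode k) == d 0 (mode l))%:R).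
have X'L : X' *m L = L *m X'.
  apply/matrixP => k l; rewrite /L diag2_mode mul_mx_diag mul_diag_mx !mxE.
  by case: eqP => [->|]; rewrite ?mulr0 ?mul0r// mulr1 mulrC.
have XX' : mxl1 (X - X') <= c1 * mxl1 F.
  rewrite /c1 -mulrA; apply: mxl1_le => k l; rewrite !mxE.
  have [e|ne] := eqVneq (d 0 (mode k)) (d 0 (mode l)).
    by rewrite mulr1 subrr normr0 !mulr_ge0 ?mxl1_ge0 ?invr_ge0// ltW.
  rewrite mulr0 subr0 mulrAC ler_pdivlMr// mulrC.
  have kl := gamP (mode k, mode l); rewrite /gap /= (negbTE ne) in kl.
  apply: le_trans (ler_wpM2r (normr_ge0 _) kl) _; rewrite -normrM.
  have -> : (d 0 (mode k) ^+ 2 - d 0 (mode l) ^+ 2) * X k l = (- (K *m F + F *m K)) k l.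
    have -> : - (K *m F + F *m K) = L *m L *m X - X *m (L *m L).
      rewrite /F mulmxBr mulmxBl -!(mulmxA X) !(mulmxA K) -(mulmxA K) addrA subrK KK.
      by rewrite mulNmx mulmxN opprK opprD opprK.
    rewrite /L !diag2_mode mulmx_diag mul_mx_diag mul_diag_mx !mxE; ring.
  apply: le_trans (mxl1_entry _ _ _) _; rewrite mxl1N.
  have -> : 2 * mxl1 K * mxl1 F = mxl1 K * mxl1 F + mxl1 F * mxl1 K by ring.
  by apply: mxl1D_le; apply: mxl1M.
have jj : j *m j = - 1%:M by apply: mulJJ.
have jT : j^T = - j by apply: tr_J.
pose T := 2^-1 *: (X' + j^T *m X' *m j).
have X'T : X' - T = - 2^-1 *: ((K *m X' - X' *m K) *m Li *m j).
  have -> : (K *m X' - X' *m K) *m Li = j^T *m X' - X' *m j^T.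
    rewrite /K -/L -/j -mulmxA -X'L !mulmxA -mulmxBl -mulmxA LLi mulmx1.
    by [].
  rewrite mulmxBl -(mulmxA X') mul_trJJ mulmx1 /T scaleNr -scalerN opprB.
  rewrite -[X' in X' - _]scale1r; set Z := _ *m j.
  rewrite scalerDr scalerBr opprD addrA -scalerBl; congr (_ *: _ - _).
  by field.
exists T; split.
- rewrite /T -scalemxAl -scalemxAr mulmxDl mulmxDr X'L; congr (_ *: (_ + _)).
  rewrite -mulmxA J_diag2 -/L -/j !mulmxA -jL; congr (_ *m _).
  by rewrite -!mulmxA X'L.
- rewrite /T -scalemxAl -scalemxAr mulmxDl mulmxDr; congr (_ *: _).
  rewrite jT !mulNmx -!mulmxA jj !mulmxN mulmx1 opprK (mulmxA j j) jj.
  by rewrite mulNmx mul1mx opprK addrC.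
rewrite -[X - T](subrKA X') mulrDl; apply: mxl1D_le => //.
have -> : c2 * mxl1 F = 2^-1 *
    ((mxl1 F + (mxl1 K * (c1 * mxl1 F) + c1 * mxl1 F * mxl1 K)) * mxl1 Li * mxl1 j).
  by rewrite /c2; ring.
rewrite X'T mxl1Z normrN ger0_norm ?invr_ge0// ler_wpM2l ?invr_ge0//.
do 2 apply: mxl1M_le => //.
have -> : K *m X' - X' *m K = F - (K *m (X - X') - (X - X') *m K).
  rewrite /F mulmxBr mulmxBl.
  move: (K *m X) (X *m K) (K *m X') (X' *m K) => M1 M2 M3 M4.
  by apply/matrixP => a b; rewrite !mxE; ring.
by apply: mxl1B_le => //; apply: mxl1B_le; apply: mxl1M_le.
Qed.

End Commutant.

(** * Perturbation of Williamson bases *)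

Section Perturbation.
Variables (R : realType) (n : nat).
Implicit Types (A S X E : 'M[R]_(n + n)) (d e : 'rV[R]_n).

Lemma Sp1 : Sp (1%:M : 'M[R]_(n + n)).
Proof. by rewrite /Sp /= trmx1 mul1mx mulmx1. Qed.

Lemma diag2_form_ge d b (x : 'cV[R]_(n + n)) : (forall i, b <= d 0 i) ->
  b * dot x x <= dot x (diag2 d *m x).
Proof.
move=> bd; rewrite diag2_mode dot_diag dotE mulr_sumr; apply: ler_sum => l _.
by rewrite mxE expr2 ler_wpM2r// -expr2 sqr_ge0.
Qed.

(** With [t = mxl1 E / b], one has
[(1 - t) (diag2 d) <= diag2 d + E <= (1 + t) (diag2 d)] as quadratic forms, and
symplectic eigenvalues are monotone and homogeneous. *)
Lemma symplectic_eigenvalue_perturbation d e X E b :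
  0 < b -> (forall i, b <= d 0 i) -> (forall i, 0 < e 0 i) ->
  (forall i j : 'I_n, (i <= j)%N -> d 0 i <= d 0 j) ->
  (forall i j : 'I_n, (i <= j)%N -> e 0 i <= e 0 j) ->
  Sp X -> X^T *m (diag2 d + E) *m X = diag2 e -> mxl1 E <= b / 2 ->
  forall j, `|e 0 j - d 0 j| <= mxl1 E / b * d 0 j.
Proof.
move=> b0 bd e0 d_sorted e_sorted hX XE Eb j.
have d0 i : 0 < d 0 i by apply: lt_le_trans (bd i).
pose t := mxl1 E / b.
have t0 : 0 <= t by rewrite divr_ge0 ?mxl1_ge0 ?ltW.
have t1 : t <= 2^-1 by rewrite ler_pdivrMr// mulrC.
have tb : mxl1 E = t * b by rewrite divfK// gt_eqF.
have L1 : (1%:M)^T *m diag2 d *m 1%:M = diag2 d by rewrite trmx1 mul1mx mulmx1.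
have Eform x : `|dot x (E *m x)| <= t * dot x (diag2 d *m x).
  apply: le_trans (quadratic_form_le _ _) _; rewrite tb -mulrA ler_wpM2l//.
  exact: diag2_form_ge.
have upper : e 0 j <= (1 + t) * d 0 j.
  apply: (symplectic_minmax _ hX Sp1 XE L1) => // [|x]; first by lra.
  rewrite mulmxDl dotDr; have := Eform x; rewrite ler_norml; lra.
have lower : d 0 j <= (1 - t)^-1 * e 0 j.
  apply: (symplectic_minmax _ Sp1 hX L1 XE) => // [|x].
    by rewrite invr_gt0; lra.
  rewrite mulrC ler_pdivlMr; last by lra.
  rewrite mulmxDl dotDr; have := Eform x; rewrite ler_norml; lra.
rewrite mulrC ler_pdivlMr in lower; last by lra.
by rewrite -/t ler_norml; lra.
Qed.

(** The form [diag2 d + E] is at least [b / 2] times the Euclidean one, and it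
takes the value [e k] on the [k]-th column of [X]. *)
Lemma williamson_basis_bound d e X E b c :
  0 < b -> (forall i, b <= d 0 i) -> (forall i, e 0 i <= c) ->
  X^T *m (diag2 d + E) *m X = diag2 e -> mxl1 E <= b / 2 ->
  mxl1 X <= (n + n)%:R * (n + n)%:R * (1 + 2 * c / b).
Proof.
move=> b0 bd ec XE Eb; apply: mxl1_le => i k.
have Xk : dot (col k X) ((diag2 d + E) *m col k X) = e 0 (mode k).
  transitivity ((X^T *m (diag2 d + E) *m X) k k).
    rewrite -mulmxA mxE dotE; apply: eq_bigr => l _.
    by rewrite mxE colE mulmxA -colE !mxE.
  by rewrite XE diag2_mode !mxE eqxx.
have X2 : X i k ^+ 2 <= dot (col k X) (col k X).
  rewrite dotE (bigD1 i)//= !mxE -expr2 lerDl; apply: sumr_ge0 => l _.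
  by rewrite -expr2 sqr_ge0.
have h1 := diag2_form_ge (col k X) bd.
have := quadratic_form_le E (col k X); rewrite ler_norml => /andP[h2 _].
have X_ge0 := dot_ge0 (col k X).
move: Xk; rewrite mulmxDl dotDr => Xk.
have h3 : mxl1 E * dot (col k X) (col k X) <= b / 2 * dot (col k X) (col k X).
  by rewrite ler_wpM2r.
have h4 := ec (mode k).
have h5 : X i k ^+ 2 <= 2 * c / b.
  rewrite ler_pdivlMr//; have : X i k ^+ 2 * b <= dot (col k X) (col k X) * b.
    by rewrite ler_wpM2r// ltW.
  lra.
by rewrite ler_norml; nra.
Qed.

(** The constants follow the construction: [cX] bounds [X], [cF] the
commutator of [X] with [K], [cT] the distance from [X] to the commuting matrix
[T], [cG] the defect of orthogonality of [T], and [cW] the distance from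
[(T^T T)^(-1/2)] to the identity; each of the last four is a coefficient of
[mxl1 E]. *)
Theorem williamson_basis_perturbation d :
  (forall i, 0 < d 0 i) -> (forall i j : 'I_n, (i <= j)%N -> d 0 i <= d 0 j) ->
  exists c delta : R, [/\ 0 < c, 0 < delta & forall E X e,
    (forall i, 0 < e 0 i) -> (forall i j : 'I_n, (i <= j)%N -> e 0 i <= e 0 j) ->
    Sp X -> X^T *m (diag2 d + E) *m X = diag2 e -> mxl1 E < delta ->
    exists Y, [/\ Sp Y, Y^T *m diag2 d *m Y = diag2 d & mxl1 (X - Y) <= c * mxl1 E]].
Proof.
move=> d0 d_sorted.
have [b b0 bd] := fin_lower_bound d0.
have [u u0 du] := fin_upper_bound d0.
have [a a0 commutant] := near_commutant d0.
set j := J R n; set L := diag2 d; pose K := j^T *m L.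
pose N : R := (n + n)%:R.
pose cX := N * N * (1 + 2 * (2 * u) / b).
pose cF := cX * mxl1 j * (N * N * (b^-1 * u)) + mxl1 j * cX.
pose cT := a * cF.
pose cG := mxl1 j * ((cX + cT) * mxl1 j * cT + cT * mxl1 j * cX).
pose cW := N ^+ 6 * 2 * cG.
pose c := cT + (cX + cT) * cW.
have jn := mxl1_ge0 j; have N0 : 0 <= N by [].
have cX0 : 0 <= cX.
  by do ?[exact: N0|exact: ltW|apply: addr_ge0|apply: mulr_ge0|rewrite invr_ge0].
have cF0 : 0 <= cF.
  by do ?[exact: N0|exact: jn|exact: cX0|exact: ltW|apply: addr_ge0|apply: mulr_ge0
         |rewrite invr_ge0].
have cT0 : 0 <= cT by apply: mulr_ge0.
have cG0 : 0 <= cG.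
  by do ?[exact: jn|exact: cX0|exact: cT0|apply: addr_ge0|apply: mulr_ge0].
have cW0 : 0 <= cW by rewrite mulr_ge0// mulr_ge0// exprn_ge0.
have c0 : 0 <= c.
  by do ?[exact: cT0|exact: cX0|exact: cW0|apply: addr_ge0|apply: mulr_ge0].
have [delta delta0 deltaP] : exists2 delta : R, 0 < delta &
    forall h, 0 <= h -> h < delta -> [/\ h <= b / 2, h <= 1 & cG * h <= 2^-1].
  have [|delta delta0 deltaP] := @fin_lower_bound _ _
    (* The default value [1] of [nth] supplies the third bound, [h <= 1]. *)
    (fun i : 'I_3 => nth 1 [:: b / 2; (2 * (cG + 1))^-1] i).
    case; case=> [|[|[|//]]] //= _; rewrite ?divr_gt0// invr_gt0; lra.
  exists delta => // h h0 hd.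
  move: (deltaP ord0) (deltaP (Ordinal (isT : 1 < 3)%N))
    (deltaP (Ordinal (isT : 2 < 3)%N)) => /= p1 p2 p3.
  split; try lra.
  have : h * (2 * (cG + 1)) <= 1.
    by rewrite -ler_pdivlMr ?div1r; lra.
  lra.
exists (c + 1), delta; split=> // [|E X e e0 e_sorted hX XE Ed]; first by lra.
set h := mxl1 E; have h0 : 0 <= h by apply: mxl1_ge0.
have [hb h1 hG] := deltaP _ h0 Ed.
have ed := symplectic_eigenvalue_perturbation b0 bd e0 d_sorted e_sorted hX XE hb.
have eu i : e 0 i <= 2 * u.
  have := ed i; have := du i; have := d0 i.
  have t1 : mxl1 E / b <= 2^-1 by rewrite ler_pdivrMr// mulrC.
  have t0 : 0 <= mxl1 E / b by rewrite divr_ge0// ltW.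
  rewrite ler_norml; nra.
have Xb : mxl1 X <= cX := williamson_basis_bound b0 bd eu XE hb.
have jT : mxl1 j^T = mxl1 j by apply: mxl1_trmx.
have Fb : mxl1 (K *m X - X *m K) <= cF * h.
  have -> : K *m X - X *m K = X *m j^T *m (diag2 e - L) - j^T *m E *m X.
    have XjT : X *m j^T *m X^T = j^T.
      by rewrite tr_J mulmxN mulNmx Sp_trmx.
    rewrite mulmxBr -XE /K -/L -/j !mulmxA XjT mulmxDr mulmxDl.
    by rewrite addrAC addrK.
  have -> : cF * h = cX * mxl1 j * (N * N * (b^-1 * u) * h) + mxl1 j * h * cX.
    by rewrite /cF; ring.
  apply: mxl1B_le; last by apply: mxl1M_le => //; apply: mxl1M_le; rewrite ?jT.
  apply: mxl1M_le; first by apply: mxl1M_le; rewrite ?jT.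
  rewrite -[N * N * _ * h]mulrA; apply: mxl1_le => k l.
  have ub : 0 <= b^-1 * u * h by rewrite !mulr_ge0 ?invr_ge0// ltW.
  rewrite /L !diag2_mode !mxE; case: eqP => _; last by rewrite !mulr0n subr0 normr0.
  rewrite !mulr1n; apply: le_trans (ed _) _.
  have -> : b^-1 * u * h = h / b * u by ring.
  by rewrite ler_wpM2l// divr_ge0// ltW.
have [T [TL Tj XT]] := commutant X.
have {}XT : mxl1 (X - T) <= cT * h.
  by apply: le_trans XT _; rewrite /cT -mulrA ler_wpM2l.
have Tb : mxl1 T <= cX + cT.
  rewrite -[T](subKr X); apply: mxl1B_le => //.
  by apply: le_trans XT _; rewrite -[leRHS]mulr1 ler_wpM2l.
have TTj : T^T *m j = j *m T^T.
  apply: trmx_inj; rewrite !trmx_mul trmxK tr_J mulNmx mulmxN.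
  by rewrite Tj.
have LT : L^T = L by rewrite /L diag2E tr_diag_mx.
have TTL : T^T *m L = L *m T^T.
  by apply: trmx_inj; rewrite !trmx_mul trmxK LT TL.
pose G := T^T *m T.
have Gsym : G^T = G by rewrite /G trmx_mul trmxK.
have Gb : mxl1 (G - 1%:M) <= cG * h.
  have -> : G - 1%:M = j^T *m (T^T *m j *m (T - X) + (T - X)^T *m j *m X).
    transitivity (j^T *m (j *m (G - 1%:M))); first by rewrite mulmxA mul_trJJ mul1mx.
    congr (_ *m _); rewrite mulmxBr mulmx1 /G mulmxA -TTj mulmxBr linearB /= !mulmxBl.
    by rewrite hX addrA subrK.
  have TX : mxl1 (T - X) <= cT * h by rewrite -mxl1N opprB.
  have -> : cG * h = mxl1 j * ((cX + cT) * mxl1 j * (cT * h) + cT * h * mxl1 j * cX).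
    by rewrite /cG; ring.
  apply: mxl1M_le; rewrite ?jT//.
  by apply: mxl1D_le; do ?[apply: mxl1M_le] => //; rewrite mxl1_trmx.
have [|W [WT WGW Wcomm Wb]] := inv_sqrt_near_identity Gsym; first exact: le_trans hG.
have Wj : j *m W = W *m j.
  by apply: Wcomm; rewrite /G mulmxA -TTj -!mulmxA Tj.
have WL : L *m W = W *m L.
  by apply: Wcomm; rewrite /G mulmxA -TTL -!mulmxA TL.
have conjY Z : T *m Z = Z *m T -> Z *m W = W *m Z ->
    (T *m W)^T *m Z *m (T *m W) = Z.
  move=> TZ WZ; rewrite trmx_mul WT -!mulmxA.
  rewrite (mulmxA Z) -TZ -(mulmxA T) WZ (mulmxA T^T) (mulmxA _ W) (mulmxA W).
  by rewrite -/G mulmxA WGW mul1mx.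
(* Conjugation by the orthogonal matrix [T W] fixes [J] and [L], with both of
   which it commutes. *)
exists (T *m W); split; [exact: conjY|exact: conjY|].
have -> : X - T *m W = (X - T) - T *m (W - 1%:M).
  by rewrite mulmxBr mulmx1 opprB addrA subrK.
have : cT * h + (cX + cT) * (cW * h) <= (c + 1) * h.
  have -> : cT * h + (cX + cT) * (cW * h) = c * h by rewrite /c; ring.
  by rewrite ler_wpM2r//; lra.
apply: le_trans; apply: mxl1B_le => //; apply: mxl1M_le => //.
by apply: le_trans Wb _; rewrite /cW -[leRHS]mulrA ler_wpM2l// mulr_ge0// exprn_ge0.
Qed.

End Perturbation.

Theorem theorem8 (R : realType) (n : nat) (A : 'M[R]_(n + n)) (hA : Pd A) :
  exists c delta : R, [/\ 0 < c, 0 < delta &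
    forall H : 'M[R]_(n + n), Sm H -> Pd (A + H) ->
    forall St : 'M[R]_(n + n), SpA (A + H) St ->
    exists2 S : 'M[R]_(n + n), SpA A S &
      spectral_norm H < delta ->
      spectral_norm (St - S) <= c * spectral_norm H].
Proof.
have := symplectic_eigenvaluesP hA; set d := symplectic_eigenvalues A.
case=> d0 d_sorted [S0 hS0 S0A].
have [c [delta [c0 delta0 perturb]]] := williamson_basis_perturbation d0 d_sorted.
pose N : R := (n + n)%:R.
pose k := mxl1 S0 * (N * N) * mxl1 S0 + 1.
have N0 : 0 <= N by [].
have S00 := mxl1_ge0 S0.
have k0 : 0 < k by rewrite ltr_wpDl// !mulr_ge0.
exists (mxl1 S0 * (c * k) + 1), (delta / k); split.
- by rewrite ltr_wpDl// !mulr_ge0// ltW.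
- by rewrite divr_gt0.
move=> H hH hAH St [hSt StAH].
have [e0 e_sorted _] := symplectic_eigenvaluesP hAH.
have [Hsmall|Hlarge] := ltP (spectral_norm H) (delta / k); last by exists S0.
have S0u := Sp_unitmx hS0.
pose E := S0^T *m H *m S0.
have [X XS] : exists X, X = invmx S0 *m St by eexists.
have Ek : mxl1 E <= k * spectral_norm H.
  apply: (@le_trans _ _ (mxl1 S0 * (N * N * spectral_norm H) * mxl1 S0)).
    by do ?apply: mxl1M_le => //; rewrite ?mxl1_trmx ?mxl1_le_spectral_norm.
  by rewrite /k mulrDl mul1r; have := spectral_norm_ge0 H; nra.
have StX : St = S0 *m X by rewrite XS mulmxA mulmxV// mul1mx.
have XE : X^T *m (diag2 d + E) *m X = diag2 (symplectic_eigenvalues (A + H)).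
  by rewrite -StAH StX -S0A /E -mulmxDl -mulmxDr trmx_mul !mulmxA.
have hX : Sp X by rewrite XS; apply: SpM => //; apply: Sp_invmx.
have [|Y [hY YL XY]] := perturb E X _ e0 e_sorted hX XE.
  by apply: le_lt_trans Ek _; rewrite mulrC -ltr_pdivlMr.
exists (S0 *m Y) => [|_].
  split; first exact: SpM.
  by rewrite -/d -[RHS]YL -S0A trmx_mul !mulmxA.
apply: le_trans (spectral_norm_le_mxl1 _) _.
rewrite StX -mulmxBr mulrDl mul1r -mulrA.
apply: (@le_trans _ _ (mxl1 S0 * (c * k * spectral_norm H))).
  apply: mxl1M_le => //; apply: le_trans XY _.
  by rewrite -mulrA ler_wpM2l// ltW.
by rewrite lerDl spectral_norm_ge0.
Qed.
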